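(* Let $A\in\mathbb{R}^{n\times n}$ be symmetric, $B\in\mathbb{R}^{n\times n}$ symmetric positive definite with smallest eigenvalue $\lambda_1(B)$, and let $u\in\mathbb{R}^n$ be nonzero. For every $\alpha\in\mathbb{R}$ there exists an eigenvalue $\lambda$ of the generalized eigenvalue problem $Ax=\lambda Bx$ such that $$|\lambda-\alpha|\le\frac{\|(A-\alpha B)u\|}{\lambda_1(B)\,\|u\|},$$ and hence $$\frac{|\lambda-\alpha|}{\sqrt{1+\lambda^2}\,\sqrt{1+\alpha^2}}\ \le\ \frac{1}{\lambda_1(B)}\cdot\frac{1}{\sqrt{1+\lambda^2}\,\|u\|}\cdot\frac{\|(A-\alpha B)u\|}{\sqrt{1+\alpha^2}}.$$ Moreover, if $u^TABu\ne0$, then the right-hand side of the last inequality, regarded as a function of $\alpha\in\mathbb{R}$ for fixed $\lambda$, is minimized when $\alpha$ is the generalized homogeneous Rayleigh quotient of $(A,B)$ at $u$.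
   Context: $\|\cdot\|$ is the Euclidean norm. The left-hand side of the second inequality is the chordal distance between $\lambda$ and $\alpha$. For $u^TABu\ne0$ the generalized homogeneous Rayleigh quotient of $(A,B)$ at $u$ is $$\frac{1}{2\,u^TABu}\Big[u^TA^2u-u^TB^2u+\sqrt{(u^TA^2u-u^TB^2u)^2+4(u^TABu)^2}\Big];$$ equivalently, it is the ratio $\alpha_1/\alpha_2$, where $(\alpha_1,\alpha_2)$ minimizes $\frac{\|\alpha_1Bu-\alpha_2Au\|}{\sqrt{\alpha_1^2+\alpha_2^2}}$ over $\mathbb{R}^2\setminus\{0\}$ (modulo nonzero scalars). *)

(* Defs.v *)
From mathcomp Require Import all_boot all_order all_algebra reals.

Set Implicit Arguments.
Unset Strict Implicit.
Unset Printing Implicit Defensive.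

Import Order.TTheory GRing.Theory Num.Theory.
Local Open Scope ring_scope.

(* Vectors of R^n are column vectors.  The Euclidean norm is defined here      *)
(* because the norm that MathComp-Analysis puts on matrices is the sup norm.   *)
Definition enorm (R : realType) (n : nat) (x : 'cV[R]_n) : R :=
  Num.sqrt (\sum_(i < n) x i 0 ^+ 2).

Definition qform (R : realType) (n : nat) (M : 'M[R]_n) (x : 'cV[R]_n) : R :=
  (x^T *m M *m x) 0 0.

Definition posdefmx (R : realType) (n : nat) (B : 'M[R]_n) : Prop :=
  B \is symmetricmx /\ forall x : 'cV[R]_n, x != 0 -> 0 < qform B x.

(* [eigenvalue] is stated with row vectors (v *m B = a *: v); the eigenvalues  *)
(* of a square matrix acting on rows and on columns are the same.              *)
Definition smallest_eigenvalue (R : realType) (n : nat) (B : 'M[R]_n) (b : R) :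
    Prop :=
  eigenvalue B b /\ forall c : R, eigenvalue B c -> b <= c.

Definition gen_eigenvalue (R : realType) (n : nat) (A B : 'M[R]_n) (lam : R) :
    Prop :=
  exists2 x : 'cV[R]_n, x != 0 & A *m x = lam *: (B *m x).

(* Meaningful only when qform (A *m B) u != 0. *)
Definition gen_hom_rayleigh (R : realType) (n : nat) (A B : 'M[R]_n)
    (u : 'cV[R]_n) : R :=
  let d := qform (A *m A) u - qform (B *m B) u in
  let c := qform (A *m B) u in
  1 / (2 * c) * (d + Num.sqrt (d ^+ 2 + 4 * c ^+ 2)).

(* Upper bound on the chordal distance between lam and alpha; b1 stands for    *)
(* the smallest eigenvalue of B.                                               *)
Definition chordal_bound (R : realType) (n : nat) (A B : 'M[R]_n) (b1 : R)
    (u : 'cV[R]_n) (lam alpha : R) : R :=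
  1 / b1 * (1 / (Num.sqrt (1 + lam ^+ 2) * enorm u))
  * (enorm ((A - alpha *: B) *m u) / Num.sqrt (1 + alpha ^+ 2)).

(* Main.v *)
(* Write C = A - alpha B and r = C u.  The minimum mu of the Rayleigh quotient of
   C B^-1 C relative to B is attained, hence is an eigenvalue of (B^-1 C)^2, so
   sqrt mu or - sqrt mu is an eigenvalue of B^-1 C and alpha plus it is one of
   (A, B).  Testing the quotient at u gives mu u^T B u <= r^T B^-1 r, and
   b1 |u|^2 <= u^T B u, r^T B^-1 r <= |r|^2 / b1 give the bound.  For the last
   part, the squared bound is, up to a factor, the Rayleigh quotient at
   (alpha, 1) of a symmetric 2 x 2 matrix, and the homogeneous Rayleigh quotient
   is the slope of the eigenvector of its smaller eigenvalue. *)
Require Import Defs.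
From mathcomp Require Import all_boot all_order all_algebra reals.
From mathcomp Require Import boolp classical_sets topology normedtype derive.
From mathcomp Require Import ring lra.

Set Implicit Arguments.
Unset Strict Implicit.
Unset Printing Implicit Defensive.

Import Order.TTheory GRing.Theory Num.Theory.
Import numFieldNormedType.Exports.
Local Open Scope ring_scope.

(** * Euclidean inner product and norm *)

Definition dot (R : realType) (n : nat) (x y : 'cV[R]_n) : R := (x^T *m y) 0 0.

Lemma dotE (R : realType) (n : nat) (x y : 'cV[R]_n) :
  dot x y = \sum_(i < n) x i 0 * y i 0.
Proof. by rewrite /dot mxE; apply: eq_bigr => i _; rewrite mxE. Qed.

Lemma dotC (R : realType) (n : nat) (x y : 'cV[R]_n) : dot x y = dot y x.
Proof. by rewrite !dotE; apply: eq_bigr => i _; rewrite mulrC. Qed.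

Lemma dotDr (R : realType) (n : nat) (x y z : 'cV[R]_n) :
  dot x (y + z) = dot x y + dot x z.
Proof. by rewrite /dot mulmxDr mxE. Qed.

Lemma dotZr (R : realType) (n : nat) (a : R) (x y : 'cV[R]_n) :
  dot x (a *: y) = a * dot x y.
Proof. by rewrite /dot -scalemxAr mxE. Qed.

Lemma dotBr (R : realType) (n : nat) (x y z : 'cV[R]_n) :
  dot x (y - z) = dot x y - dot x z.
Proof. by rewrite dotDr -scaleN1r dotZr mulN1r. Qed.

Lemma dotDl (R : realType) (n : nat) (x y z : 'cV[R]_n) :
  dot (x + y) z = dot x z + dot y z.
Proof. by rewrite dotC dotDr !(dotC z). Qed.

Lemma dotBl (R : realType) (n : nat) (x y z : 'cV[R]_n) :
  dot (x - y) z = dot x z - dot y z.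
Proof. by rewrite dotC dotBr !(dotC z). Qed.

Lemma dotZl (R : realType) (n : nat) (a : R) (x y : 'cV[R]_n) :
  dot (a *: x) y = a * dot x y.
Proof. by rewrite dotC dotZr dotC. Qed.

Lemma dot_ge0 (R : realType) (n : nat) (x : 'cV[R]_n) : 0 <= dot x x.
Proof. by rewrite dotE sumr_ge0 // => i _; rewrite -expr2 sqr_ge0. Qed.

Lemma dot_eq0 (R : realType) (n : nat) (x : 'cV[R]_n) :
  (dot x x == 0) = (x == 0).
Proof.
apply/idP/eqP => [|->]; last by rewrite /dot mulmx0 mxE.
rewrite dotE psumr_eq0 => [/allP h|i _]; last by rewrite -expr2 sqr_ge0.
apply/colP => i; rewrite mxE; apply/eqP.
by have := h i (mem_index_enum i); rewrite mulf_eq0 orbb.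
Qed.

Lemma dot_gt0 (R : realType) (n : nat) (x : 'cV[R]_n) :
  x != 0 -> 0 < dot x x.
Proof. by move=> x0; rewrite lt_neqAle eq_sym dot_eq0 x0 dot_ge0. Qed.

(** Cauchy-Schwarz: the squared norm of (y.y) x - (x.y) y is y.y times the gap between the two
    sides. *)
Lemma dot_sqr_le (R : realType) (n : nat) (x y : 'cV[R]_n) :
  dot x y ^+ 2 <= dot x x * dot y y.
Proof.
have [->|/dot_gt0 y0] := eqVneq y 0.
  by rewrite /dot !mulmx0 mxE expr0n /= mulr0.
have := dot_ge0 (dot y y *: x - dot x y *: y).
rewrite !(dotBl, dotBr, dotZl, dotZr) (dotC y x).
set a := dot x x; set b := dot x y; set c := dot y y in y0 *.
have -> : c * (c * a - b * b) - b * (c * b - b * c) = c * (a * c - b ^+ 2).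
  by ring.
by rewrite pmulr_rge0 // subr_ge0.
Qed.

Lemma enorm_ge0 (R : realType) (n : nat) (x : 'cV[R]_n) : 0 <= enorm x.
Proof. exact: sqrtr_ge0. Qed.

Lemma enorm_sqr (R : realType) (n : nat) (x : 'cV[R]_n) :
  enorm x ^+ 2 = dot x x.
Proof.
have -> : enorm x = Num.sqrt (dot x x).
  by rewrite dotE; congr Num.sqrt; apply: eq_bigr => i _; rewrite expr2.
by rewrite sqr_sqrtr // dot_ge0.
Qed.

Lemma enorm_gt0 (R : realType) (n : nat) (x : 'cV[R]_n) :
  x != 0 -> 0 < enorm x.
Proof.
move=> /dot_gt0 x0; rewrite lt_neqAle enorm_ge0 andbT eq_sym.
by rewrite -sqrf_eq0 enorm_sqr gt_eqF.
Qed.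

(** * Quadratic forms *)

Lemma qformE (R : realType) (n : nat) (M : 'M[R]_n) (x : 'cV[R]_n) :
  qform M x = dot x (M *m x).
Proof. by rewrite /qform /dot mulmxA. Qed.

Lemma qformZ (R : realType) (n : nat) (M : 'M[R]_n) a (x : 'cV[R]_n) :
  qform M (a *: x) = a ^+ 2 * qform M x.
Proof. by rewrite !qformE -scalemxAr dotZl dotZr expr2 mulrA. Qed.

Lemma symmetricmx_tr (R : realType) (n : nat) (M : 'M[R]_n) :
  (M \is symmetricmx) = (M^T == M).
Proof. by rewrite qualifE /= expr0 scale1r map_mx_id // eq_sym. Qed.

Lemma symmetricmx_dot (R : realType) (n : nat) (M : 'M[R]_n) (x y : 'cV[R]_n) :
  M \is symmetricmx -> dot (M *m x) y = dot x (M *m y).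
Proof.
by rewrite symmetricmx_tr => /eqP Ms; rewrite /dot trmx_mul Ms mulmxA.
Qed.

Lemma qformDZ (R : realType) (n : nat) (M : 'M[R]_n) t (x y : 'cV[R]_n) :
  M \is symmetricmx ->
  qform M (x + t *: y) =
  qform M x + 2 * t * dot y (M *m x) + t ^+ 2 * qform M y.
Proof.
move=> Ms; rewrite !qformE mulmxDr -scalemxAr !(dotDl, dotDr, dotZl, dotZr).
by rewrite -(symmetricmx_dot x y Ms) (dotC (M *m x)); ring.
Qed.

(* The form is nonnegative along the line x - t M x, whose linear term in t
   is - 2 t |M x|^2. *)
Lemma qform_psd_ker (R : realType) (n : nat) (M : 'M[R]_n) (x : 'cV[R]_n) :
  M \is symmetricmx -> (forall y : 'cV[R]_n, 0 <= qform M y) ->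
  qform M x = 0 -> M *m x = 0.
Proof.
move=> Ms Mpsd Mx; apply/eqP; rewrite -dot_eq0; apply/eqP.
set y := M *m x.
have q0 := Mpsd y; have d0 := dot_ge0 y.
have q1 : 0 < qform M y + 1 by rewrite ltr_wpDl.
(* With q the form at y and d = |y|^2, the step t = d / (q + 1) makes the form equal to - t^2 (q +
   2); the + 1 keeps the denominator positive when q = 0. *)
have := Mpsd (x + - (dot y y / (qform M y + 1)) *: y).
rewrite qformDZ // Mx add0r -/y.
move: q0 d0 q1; set q := qform M y; set d := dot y y => q0 d0 q1.
have -> : 2 * - (d / (q + 1)) * d + (- (d / (q + 1))) ^+ 2 * q
   = - ((d / (q + 1)) ^+ 2 * (q + 2)).
  by field; rewrite gt_eqF.
rewrite oppr_ge0 => h.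
have /eqP : (d / (q + 1)) ^+ 2 * (q + 2) = 0.
  by apply/eqP; rewrite eq_le h mulr_ge0 ?sqr_ge0 ?addr_ge0.
rewrite mulf_eq0 sqrf_eq0 mulf_eq0 invr_eq0 (gt_eqF q1) orbF.
by rewrite (gt_eqF (_ : 0 < q + 2)) ?orbF ?ltr_wpDl // => /eqP.
Qed.

(** * Attained minima of generalized Rayleigh quotients *)

Lemma qform_continuous (R : realType) (n : nat) (M : 'M[R]_n) :
  continuous (fun v : 'rV[R]_n => qform M v^T).
Proof.
have -> : (fun v : 'rV[R]_n => qform M v^T) =
    (fun v => \sum_(i < n) (v 0 i * \sum_(j < n) M i j * v 0 j)).
  apply/funext => v; rewrite qformE dotE; apply: eq_bigr => i _.
  by rewrite !mxE; congr (_ * _); apply: eq_bigr => j _; rewrite mxE.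
have cM (f g : 'rV[R]_n -> R) :
    continuous f -> continuous g -> continuous (fun v => f v * g v).
  by move=> cf cg v; exact: (continuousM (cf v) (cg v)).
have coordc i : continuous (fun v : 'rV[R]_n => v 0 i) by exact: coord_continuous.
apply: continuous_big => [|i _]; first exact: add_continuous.
apply: (cM); first exact: coordc.
apply: continuous_big => [|j _]; first exact: add_continuous.
by apply: (cM (fun=> M i j)) => //; exact: cst_continuous.
Qed.

(** Vectors are rows here to fit [EVT_min_rV]. Boundedness refers to the sup norm, and each squared
    coordinate is at most the full sum of squares. *)
Lemma sphere_compact (R : realType) (n : nat) :
  compact [set v : 'rV[R]_n | dot v^T v^T = 1]%classic.
Proof.
apply: bounded_closed_compact.
  exists 1; split => // M M1 v /= v1.
  rewrite [leLHS]/Num.norm /= mx_normrE; apply/bigmax_leP => /=.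
  split => [|[i j] _ /=]; first exact/ltW/(lt_trans _ M1).
  apply: le_trans (ltW M1); rewrite -(@expr_le1 _ 2) // real_normK ?num_real //.
  rewrite -v1 dotE (bigD1 j) //= (ord1 i) !mxE -expr2 lerDl sumr_ge0 // => k _.
  by rewrite -expr2 sqr_ge0.
rewrite (_ : [set v | _]%classic =
  (fun v : 'rV[R]_n => qform 1%:M v^T) @^-1` [set 1])%classic.
  by apply: closed_comp => [v _|]; [exact: qform_continuous|exact: closed_eq].
by apply/seteqP; split => v /=; rewrite qformE mul1mx.
Qed.

Lemma posdefmx_neq0 (R : realType) (n : nat) (B : 'M[R]_n) (x : 'cV[R]_n) :
  posdefmx B -> x != 0 -> qform B x != 0.
Proof. by move=> [_ Bpos] /Bpos/gt_eqF ->. Qed.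

(** A minimizer v of the quotient on the unit sphere is global by homogeneity. So M - mu B is
    positive semidefinite with zero form at v, and [qform_psd_ker] puts v in its kernel. The vector
    u shows that the sphere is nonempty. *)
Lemma gen_eigenvalue_min (R : realType) (n : nat) (M B : 'M[R]_n)
    (u : 'cV[R]_n) : M \is symmetricmx -> posdefmx B -> u != 0 ->
  exists2 mu : R, gen_eigenvalue M B mu &
    forall y : 'cV[R]_n, mu * qform B y <= qform M y.
Proof.
move=> Ms Bpd u0; have [Bs Bpos] := Bpd.
pose S := [set v : 'rV[R]_n | dot v^T v^T = 1]%classic.
pose f (v : 'rV[R]_n) := qform M v^T / qform B v^T.
have unit_neq0 v : S v -> v^T != 0.
  by rewrite /S /= -dot_eq0 => ->; rewrite oner_eq0.
have normalize (y : 'cV[R]_n) : y != 0 -> S ((enorm y)^-1 *: y^T).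
  move=> y0; rewrite /S /= linearZ /= trmxK dotZl dotZr -enorm_sqr.
  by field; rewrite gt_eqF // enorm_gt0.
have [||v vS fmin] := @EVT_min_rV R n f S _ (@sphere_compact R n).
- by exists ((enorm u)^-1 *: u^T); exact: normalize.
- apply: continuous_in_subspaceT => v; rewrite inE => vS.
  have B0 : qform B v^T != 0 by exact/posdefmx_neq0/unit_neq0.
  have cV : {for v, continuous (fun w => (qform B w^T)^-1)}.
    by apply: continuousV => //; exact: qform_continuous.
  have := continuousM (@qform_continuous R n M v) cV; exact.
have x0 : v^T != 0 by apply: unit_neq0; rewrite inE in vS.
have le_min (y : 'cV[R]_n) : f v * qform B y <= qform M y.
  have [->|y0] := eqVneq y 0.
    by rewrite !qformE !mulmx0 /dot mulmx0 mxE mulr0.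
  rewrite -ler_pdivlMr ?Bpos //.
  have := fmin ((enorm y)^-1 *: y^T); rewrite inE => /(_ (normalize _ y0)).
  rewrite /f linearZ /= trmxK !qformZ -mulf_div divff ?mul1r //.
  by rewrite expf_eq0 /= invr_eq0 gt_eqF // enorm_gt0.
exists (f v) => //; exists v^T => //.
have NE (y : 'cV[R]_n) :
    qform (M - f v *: B) y = qform M y - f v * qform B y.
  by rewrite !qformE mulmxBl -scalemxAl dotBr dotZr.
apply/eqP; rewrite -subr_eq0 scalemxAl -mulmxBl; apply/eqP.
apply: qform_psd_ker => [|y|].
- rewrite symmetricmx_tr linearB /= linearZ /=.
  by move: Ms Bs; rewrite !symmetricmx_tr => /eqP -> /eqP ->.
- by rewrite NE subr_ge0.
- by rewrite NE /f divfK ?subrr // posdefmx_neq0.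
Qed.

(** * Bounds on B and its inverse from the smallest eigenvalue *)

Lemma posdefmx_unit (R : realType) (n : nat) (B : 'M[R]_n) :
  posdefmx B -> B \in unitmx.
Proof.
move=> Bpd; have [/[!symmetricmx_tr]/eqP Bs _] := Bpd.
rewrite unitmxE unitfE; apply/det0P => -[v v0 vB].
have := posdefmx_neq0 (x := v^T) Bpd; rewrite trmx_eq0 => /(_ v0).
by rewrite qformE -[X in X *m _]Bs -trmx_mul vB trmx0 /dot mulmx0 mxE eqxx.
Qed.

Lemma gen_eigenvalue1 (R : realType) (n : nat) (B : 'M[R]_n) (b : R) :
  B \is symmetricmx -> gen_eigenvalue B 1%:M b <-> eigenvalue B b.
Proof.
rewrite symmetricmx_tr => /eqP Bs; split=> [[x x0 Bx]|/eigenvalueP[v vB v0]].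
  apply/eigenvalueP; exists x^T; last by rewrite trmx_eq0.
  by rewrite -{1}Bs -trmx_mul Bx mul1mx linearZ.
exists v^T; first by rewrite trmx_eq0.
by rewrite -{1}Bs -trmx_mul vB mul1mx linearZ.
Qed.

Lemma smallest_eigenvalue_gt0 (R : realType) (n : nat) (B : 'M[R]_n) (b : R) :
  posdefmx B -> smallest_eigenvalue B b -> 0 < b.
Proof.
move=> [Bs Bpos] [/(gen_eigenvalue1 _ Bs)[x x0 Bx] _].
by have := Bpos x x0; rewrite qformE Bx mul1mx dotZr pmulr_lgt0 // dot_gt0.
Qed.

(** The minimum of the quotient of B relative to the identity is itself an eigenvalue of B, hence at
    least b. *)
Lemma smallest_eigenvalue_le (R : realType) (n : nat) (B : 'M[R]_n) (b : R)
    (y : 'cV[R]_n) :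
  B \is symmetricmx -> smallest_eigenvalue B b -> b * dot y y <= qform B y.
Proof.
move=> Bs [_ bmin]; have [->|y0] := eqVneq y 0.
  by rewrite qformE !mulmx0 /dot mulmx0 mxE mulr0.
have Ipd : posdefmx (1%:M : 'M[R]_n).
  split=> [|x x0]; first by rewrite symmetricmx_tr trmx1.
  by rewrite qformE mul1mx dot_gt0.
have [mu /(gen_eigenvalue1 _ Bs)/bmin bmu /(_ y)] := gen_eigenvalue_min Bs Ipd y0.
rewrite qformE mul1mx; apply: le_trans.
by rewrite ler_wpM2r // dot_ge0.
Qed.

(** For r = B y the form is q = y.r = y^T B y. Cauchy-Schwarz and b |y|^2 <= q give b q^2 <= b |y|^2
    |r|^2 <= q |r|^2, and q cancels unless it is 0. *)
Lemma qform_invmx_le (R : realType) (n : nat) (B : 'M[R]_n) (b : R)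
    (r : 'cV[R]_n) :
  posdefmx B -> smallest_eigenvalue B b -> qform (invmx B) r <= dot r r / b.
Proof.
move=> Bpd hb; have b0 := smallest_eigenvalue_gt0 Bpd hb.
pose y := invmx B *m r.
have rE : r = B *m y by rewrite mulKVmx // posdefmx_unit.
have qE : qform (invmx B) r = qform B y.
  by rewrite !qformE -/y dotC {1}rE.
have := smallest_eigenvalue_le y Bpd.1 hb.
have := dot_sqr_le y r; rewrite {1}rE -qformE qE.
have := dot_ge0 y; have := dot_ge0 r.
set q := qform B y; set p := dot y y; set s := dot r r => s0 p0 qs bp.
rewrite ler_pdivlMr //.
have q0 : 0 <= q by apply: le_trans bp; rewrite mulr_ge0 // ltW.
have [->|qn0] := eqVneq q 0; first by rewrite mul0r.
have qp : 0 < q by rewrite lt_neqAle eq_sym qn0.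
rewrite -(ler_pM2l qp) mulrA -expr2.
have : q ^+ 2 * b <= p * s * b by rewrite ler_wpM2r // ltW.
move=> /le_trans; apply.
by rewrite mulrAC ler_wpM2r // mulrC.
Qed.

(** * A generalized eigenvalue of small modulus *)

(* Minimising the form of C B^-1 C relative to B gives an eigenvalue s^2 of
   (B^-1 C)^2, which factors as (B^-1 C - s)(B^-1 C + s). *)
Lemma gen_eigenvalue_small (R : realType) (n : nat) (C B : 'M[R]_n) (b : R)
    (u : 'cV[R]_n) :
  C \is symmetricmx -> posdefmx B -> smallest_eigenvalue B b -> u != 0 ->
  exists2 mu : R, gen_eigenvalue C B mu &
    `|mu| <= enorm (C *m u) / (b * enorm u).
Proof.
move=> Cs Bpd hb u0; have [Bs Bpos] := Bpd.
have Bu := posdefmx_unit Bpd; have b0 := smallest_eigenvalue_gt0 Bpd hb.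
have [/eqP Ct /eqP Bt] : C^T == C /\ B^T == B by rewrite -!symmetricmx_tr.
have Ms : C *m invmx B *m C \is symmetricmx.
  by rewrite symmetricmx_tr !trmx_mul trmx_inv Ct Bt mulmxA.
have qM (y : 'cV[R]_n) :
    qform (C *m invmx B *m C) y = qform (invmx B) (C *m y).
  by rewrite !qformE -!mulmxA (symmetricmx_dot _ _ Cs).
have [mu [x x0 Mx] le_mu] := gen_eigenvalue_min Ms Bpd u0.
pose T := invmx B *m C.
have TTx : T *m (T *m x) = mu *: x.
  have -> : T *m (T *m x) = invmx B *m (C *m invmx B *m C *m x).
    by rewrite /T !mulmxA.
  by rewrite Mx -scalemxAr mulKmx.
(* With y = B^-1 C x, mu times the form of B at x is y^T B y, so mu has a real square root. *)
have mu0 : 0 <= mu.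
  have : 0 <= qform (C *m invmx B *m C) x.
    pose y := invmx B *m (C *m x).
    have CxE : C *m x = B *m y by rewrite mulKVmx.
    rewrite qM qformE -/y CxE dotC -qformE.
    apply: le_trans (smallest_eigenvalue_le y Bs hb).
    by rewrite mulr_ge0 ?dot_ge0 // ltW.
  by rewrite qformE Mx dotZr -qformE pmulr_lge0 // Bpos.
pose s := Num.sqrt mu.
have s2 : s ^+ 2 = mu by rewrite sqr_sqrtr.
have s_le : s <= enorm (C *m u) / (b * enorm u).
  have e0 := enorm_gt0 u0.
  rewrite ler_pdivlMr ?mulr_gt0 //.
  rewrite -(@ler_pXn2r _ 2) ?nnegrE ?mulr_ge0 ?sqrtr_ge0 ?enorm_ge0 ?(ltW b0) //.
  rewrite !exprMn s2 !enorm_sqr.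
  (* The chain is mu b |u|^2 <= mu u^T B u <= (C u)^T B^-1 (C u) <= |C u|^2 / b. *)
  have := le_trans (le_mu u); rewrite qM => /(_ _ (qform_invmx_le _ Bpd hb)).
  rewrite ler_pdivlMr // => h; apply: le_trans h.
  have := smallest_eigenvalue_le u Bs hb => h.
  have -> : mu * (b ^+ 2 * dot u u) = mu * (b * dot u u) * b by ring.
  by rewrite ler_wpM2r ?(ltW b0) // ler_wpM2l.
have TE lam z : T *m z = lam *: z -> C *m z = lam *: (B *m z).
  move=> Tz; rewrite -[C]mul1mx -(mulmxV Bu) -!mulmxA (mulmxA _ C) -/T Tz.
  by rewrite -scalemxAr.
(* Since (T + s)(T - s) x = 0, either x is an eigenvector of T for s, or (T - s) x is one for -
   s. *)
have [w0|w0] := eqVneq (T *m x - s *: x) 0.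
  exists s; last by rewrite ger0_norm // sqrtr_ge0.
  by exists x => //; apply: TE; apply/eqP; rewrite -subr_eq0 w0.
exists (- s); last by rewrite normrN ger0_norm // sqrtr_ge0.
exists (T *m x - s *: x) => //; apply: TE.
rewrite mulmxBr TTx -scalemxAr -s2 scalerBr scalerA mulNr -expr2 !scaleNr opprK.
by rewrite addrC.
Qed.

(** * Optimality of the homogeneous Rayleigh quotient *)

(* At r = (d + s) / (2 c) with d = a - b and s^2 = d^2 + 4 c^2, the left
   side is the smaller root (a + b - s) / 2 of the characteristic polynomial
   of ((b, -c), (-c, a)). *)
Lemma ratio_min (R : rcfType) (a b c t : R) : c != 0 ->
  let r := 1 / (2 * c) * (a - b + Num.sqrt ((a - b) ^+ 2 + 4 * c ^+ 2)) in
  (a - 2 * r * c + r ^+ 2 * b) / (1 + r ^+ 2) <=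
  (a - 2 * t * c + t ^+ 2 * b) / (1 + t ^+ 2).
Proof.
move=> c0 /=; set s := Num.sqrt _.
have s2 : s ^+ 2 = (a - b) ^+ 2 + 4 * c ^+ 2.
  by rewrite sqr_sqrtr //; apply: addr_ge0; [|apply: mulr_ge0]; rewrite ?sqr_ge0 ?ler0n.
set r := 1 / (2 * c) * _.
have rE : 2 * c * r = a - b + s by rewrite /r; field.
have q (x : R) : 0 < 1 + x ^+ 2 by apply: ltr_wpDr; rewrite ?sqr_ge0 ?ltr01.
(* Strictness comes from c != 0 and yields b - m > 0 below. *)
have sgt : `|a - b| < s.
  rewrite -(@ltr_pXn2r _ 2) ?nnegrE ?sqrtr_ge0 // s2 real_normK ?num_real //.
  by rewrite ltrDl mulr_gt0 // exprn_even_gt0.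
have [h1 h2] : a - b < s /\ - s < a - b.
  by move: sgt; rewrite ltr_norml => /andP[].
have c2E : 4 * c ^+ 2 = s ^+ 2 - (a - b) ^+ 2 by rewrite s2; ring.
pose m := (a + b - s) / 2.
have -> : (a - 2 * r * c + r ^+ 2 * b) / (1 + r ^+ 2) = m.
  apply: (canLR (mulfK _)); first by rewrite gt_eqF.
  (* After this scaling r enters only through 2 c r = a - b + s. *)
  apply: (@mulfI _ (4 * c ^+ 2)); first by rewrite mulf_neq0 ?expf_neq0 ?pnatr_eq0.
  have -> : 4 * c ^+ 2 * (a - 2 * r * c + r ^+ 2 * b) =
      4 * c ^+ 2 * a - 4 * c ^+ 2 * (2 * c * r) + (2 * c * r) ^+ 2 * b by ring.
  have -> : 4 * c ^+ 2 * (m * (1 + r ^+ 2)) = m * (4 * c ^+ 2 + (2 * c * r) ^+ 2).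
    by ring.
  by rewrite rE c2E /m; field.
rewrite ler_pdivlMr ?q // -subr_ge0.
have bm : 0 < b - m by rewrite /m; lra.
rewrite -(pmulr_rge0 _ bm).
(* As m is a characteristic root, (a - m)(b - m) = c^2, which completes the square in t. *)
have -> : (b - m) * (a - 2 * t * c + t ^+ 2 * b - m * (1 + t ^+ 2))
   = ((b - m) * t - c) ^+ 2.
  apply/eqP; rewrite -subr_eq0; apply/eqP.
  transitivity ((s ^+ 2 - (a - b) ^+ 2 - 4 * c ^+ 2) / 4); first by rewrite /m; field.
  by rewrite c2E subrr mul0r.
exact: sqr_ge0.
Qed.

Theorem mainTheorem10 (R : realType) (n : nat) (A B : 'M[R]_n) (b1 : R)
    (u : 'cV[R]_n) (hA : A \is symmetricmx) (hB : posdefmx B)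
    (hb1 : smallest_eigenvalue B b1) (hu : u != 0) :
  (forall alpha : R, exists lam : R,
     [/\ gen_eigenvalue A B lam,
         `|lam - alpha| <= enorm ((A - alpha *: B) *m u) / (b1 * enorm u)
       & `|lam - alpha| / (Num.sqrt (1 + lam ^+ 2) * Num.sqrt (1 + alpha ^+ 2))
         <= chordal_bound A B b1 u lam alpha])
  /\
  (qform (A *m B) u != 0 ->
   forall lam alpha : R,
     chordal_bound A B b1 u lam (gen_hom_rayleigh A B u)
     <= chordal_bound A B b1 u lam alpha).
Proof.
have b0 := smallest_eigenvalue_gt0 hB hb1; have e0 := enorm_gt0 hu.
have Bs := hB.1.
have q (x : R) : 0 < Num.sqrt (1 + x ^+ 2).
  by rewrite sqrtr_gt0; apply: ltr_wpDr; rewrite ?sqr_ge0 ?ltr01.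
split=> [alpha|c0 lam alpha].
  have Cs : A - alpha *: B \is symmetricmx.
    rewrite symmetricmx_tr linearB /= linearZ /=.
    by move: hA Bs; rewrite !symmetricmx_tr => /eqP -> /eqP ->.
  (* Adding alpha turns an eigenvalue of (A - alpha B, B) into one of (A, B). *)
  have [mu [x x0 Cx] mu_le] := gen_eigenvalue_small Cs hB hb1 hu.
  have muE : alpha + mu - alpha = mu by rewrite addrC addKr.
  exists (alpha + mu); rewrite muE; split => //.
    exists x => //; rewrite scalerDl -Cx mulmxBl -scalemxAl.
    by rewrite addrC subrK.
  rewrite /chordal_bound.
  move: mu_le; set e := enorm (_ *m u) => mu_le.
  set p := Num.sqrt (1 + (alpha + mu) ^+ 2); set p' := Num.sqrt _.
  have -> : 1 / b1 * (1 / (p * enorm u)) * (e / p') =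
            e / (b1 * enorm u) / (p * p').
    by field; rewrite !gt_eqF //; exact: q.
  by rewrite ler_wpM2r // invr_ge0 mulr_ge0 // sqrtr_ge0.
(* The factor free of alpha is nonnegative, so only the last factor has to be minimized, and its
   square suffices. *)
rewrite /chordal_bound ler_wpM2l //.
  by rewrite mulr_ge0 // mul1r invr_ge0 ?mulr_ge0 ?sqrtr_ge0 // ltW.
set rho := gen_hom_rayleigh A B u.
have ge0 (x : R) : 0 <= enorm ((A - x *: B) *m u) / Num.sqrt (1 + x ^+ 2).
  by rewrite divr_ge0 ?sqrtr_ge0.
rewrite -(@ler_pXn2r _ 2) ?nnegrE ?ge0 //.
(* Symmetry of A and B merges the two cross terms of |A u - x B u|^2 into u^T A B u, giving the form
   of [ratio_min]. *)
have sqE (x : R) : (enorm ((A - x *: B) *m u) / Num.sqrt (1 + x ^+ 2)) ^+ 2 =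
   (qform (A *m A) u - 2 * x * qform (A *m B) u + x ^+ 2 * qform (B *m B) u)
   / (1 + x ^+ 2).
  rewrite expr_div_n enorm_sqr sqr_sqrtr ?addr_ge0 ?sqr_ge0 //; congr (_ / _).
  rewrite !qformE mulmxBl -scalemxAl -!mulmxA.
  rewrite -(symmetricmx_dot u (A *m u) hA) -(symmetricmx_dot u (B *m u) hA).
  rewrite -(symmetricmx_dot u (B *m u) Bs).
  rewrite !(dotBl, dotBr, dotZl, dotZr) (dotC (B *m u) (A *m u)).
  by ring.
by rewrite !sqE; exact: ratio_min.
Qed.
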